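(* Let $r\sim\mathcal{U}(0,1)$ and let $c$ be a random variable with values in $[0,1]$, independent of $r$, with cumulative distribution function $F$. Define $$\ell=\begin{cases} c & \text{if } c\ge r,\\ 1-c & \text{if } c<r.\end{cases}$$ Then the cumulative distribution function of $\ell$ is, for $t\in[0,1]$, $$H(t)=\int_0^t x\,\mathrm{d}F(x)+\int_{1-t}^1(1-x)\,\mathrm{d}F(x).$$ Moreover, if $c$ has a probability density function $f$, then $\ell$ has the probability density function $$h(t)=t\bigl(f(t)+f(1-t)\bigr),\qquad t\in[0,1].$$
   Context: $\mathcal{U}(0,1)$ is the uniform distribution on $(0,1)$. Integrals are Lebesgue--Stieltjes integrals with respect to the law of $c$, including endpoints: $\int_a^b g(x)\,\mathrm{d}F(x)=\mathbb{E}[g(c)\mathbf{1}_{\{a\le c\le b\}}]$ (so atoms at $a$ and $b$, including at $0$, are counted). *)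

(* Defs.v *)
From HB Require Import structures.
From mathcomp Require Import all_boot all_order all_algebra.
From mathcomp Require Import all_classical all_reals all_analysis.
From mathcomp Require Import measurable_realfun.
Set Implicit Arguments.
Unset Strict Implicit.
Unset Printing Implicit Defensive.
Import Order.TTheory GRing.Theory Num.Theory.
Import numFieldNormedType.Exports.
Local Open Scope classical_set_scope.
Local Open Scope ring_scope.

Section definitions.
Context d (T : measurableType d) (R : realType) (P : probability T R).

(* Laws are compared on Borel sets only: a measure is a total function on
   [set R] whose values on non-measurable sets carry no meaning. *)
Definition has_law (X : {RV P >-> R}) (m : set R -> \bar R) : Prop :=
  forall A : set R, measurable A -> distribution P X A = m A.

Definition independent_RV (X Y : {RV P >-> R}) : Prop :=
  forall A B : set R, measurable A -> measurable B ->
    P (X @^-1` A `&` Y @^-1` B) = (P (X @^-1` A) * P (Y @^-1` B))%E.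

Definition has_pdf (X : {RV P >-> R}) (f : R -> R) : Prop :=
  [/\ measurable_fun [set: R] f,
      forall x, 0 <= f x &
      has_law X (fun A => (\int[lebesgue_measure]_(x in A) (f x)%:E)%E)].

Definition ell (c r : {RV P >-> R}) (w : T) : R :=
  if r w <= c w then c w else 1 - c w.

Lemma measurable_ell (c r : {RV P >-> R}) : measurable_fun [set: T] (ell c r).
Proof.
apply: measurable_fun_if => //.
- exact: measurable_fun_ler.
- exact: measurable_funTS.
- by apply: measurable_funTS; apply: measurable_funB.
Qed.

HB.instance Definition _ (c r : {RV P >-> R}) :=
  @isMeasurableFun.Build _ _ _ _ (ell c r) (measurable_ell c r).

End definitions.

Section stieltjes.
Context d (T : measurableType d) (R : realType) (P : probability T R).
Variables (c : {RV P >-> R}) (F : cumulative R R).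
Hypothesis hF : forall x, cdf c x = (F x)%:E.

(* [R] and [measurableTypeR R] carry the same Borel sigma-algebra under two
   different displays; Lebesgue-Stieltjes measures live on the latter. *)
Let cR : T -> measurableTypeR R := c.

Let measurable_cR : measurable_fun [set: T] cR.
Proof. by move=> _ Y mY; apply: (@measurable_funPT _ _ _ _ c). Qed.

#[local] HB.instance Definition _ :=
  @isMeasurableFun.Build _ _ _ _ cR measurable_cR.

Lemma lebesgue_stieltjes_measure_law (A : set R) : measurable A ->
  lebesgue_stieltjes_measure F A = distribution P c A.
Proof.
move=> mA.
apply: (@lebesgue_stieltjes_measure_unique R F (distribution P cR)) => [I [[a b]]/= _ <- | //].
rewrite /lebesgue_stieltjes_measure /measure_extension/=.
rewrite measurable_mu_extE/=; last exact: is_ocitv.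
have [ab | ba] := leP a b; last first.
  by rewrite set_itv_ge ?wlength0 ?measure0// bnd_simp -leNgt ltW.
rewrite wlength_itv_bnd// EFinB -!hF /cdf -[distribution P c]/(distribution P cR).
have -> : `]a, b]%classic = `]-oo, b] `\` `]-oo, a].
  by rewrite -[RHS]setCK setCD setCitvl setUC -[LHS]setCK setCitv.
rewrite measureD ?setIidr//; first exact: subset_itvl.
by rewrite -ge0_fin_numE// fin_num_measure.
Qed.

(* Integration over the closed interval [a, b] against the Lebesgue-Stieltjes
   measure of F counts the atoms of the law of c at a and b, even at a = 0,
   since F is defined on the whole line and vanishes on the negative reals
   when c is nonnegative. *)
Lemma lebesgue_stieltjes_integralE (a b : R) (g : R -> R) :
  measurable_fun [set: R] g -> (forall x, x \in `[a, b] -> 0 <= g x) ->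
  (\int[lebesgue_stieltjes_measure F]_(x in `[a, b]) (g x)%:E =
   'E_P[fun w => (g (c w) * \1_`[a, b] (c w))%R])%E.
Proof.
move=> mg g0.
rewrite (eq_measure_integral (distribution P cR)); last first.
  by move=> A mA _; exact: lebesgue_stieltjes_measure_law.
rewrite integral_mkcond unlock.
have -> : (fun x => (g x)%:E) \_ `[a, b] = (fun x => (g x * \1_`[a, b] x)%:E).
  apply/funext => x; rewrite patchE indicE.
  by case: ifP => _; rewrite ?mulr1 ?mulr0.
have mI : measurable_fun [set: R] (\1_`[a, b] : R -> R).
  by apply: measurable_indic; exact: measurable_itv.
have mgI : measurable_fun [set: R] (fun x => (g x * \1_`[a, b] x)%:E).
  by apply/measurable_EFinP; exact: measurable_funM.
rewrite ge0_integral_distribution//.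
move=> y; rewrite lee_fin indicE.
case: (boolP (y \in _)) => [yab|_]; last by rewrite mulr0.
by rewrite mulr1; apply: g0; move: yab; rewrite inE.
Qed.

End stieltjes.

(* Main.v *)
Require Import Defs.
From HB Require Import structures.
From mathcomp Require Import all_boot all_order all_algebra.
From mathcomp Require Import all_classical all_reals all_analysis.
From mathcomp Require Import measurable_realfun lra.
Set Implicit Arguments.
Unset Strict Implicit.
Unset Printing Implicit Defensive.
Import Order.TTheory GRing.Theory Num.Theory.
Import numFieldNormedType.Exports.
Local Open Scope classical_set_scope.
Local Open Scope ring_scope.

(** The law of [ell c r] is computed on every Borel set [A], not only on the
    half-lines, because the density statement needs all of them.  The event
    [ell c r \in A] is the disjoint union of [c \in A, r <= c] and
    [1 - c \in A, c < r].  Since [c] and [r] are independent, their joint law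
    is a product, so each of the two probabilities is obtained by freezing
    [c = x] and integrating the probability of the remaining event on [r]
    against the law of [c] (lemma [independent_section_prob]).  For [r]
    uniform and [x] in [0, 1] that inner probability is [x] for [r <= x] and
    [1 - x] for [x < r].  This gives (lemma [ell_law])

      P (ell \in A) = E [c ; c \in A] + E [1 - c ; 1 - c \in A].

    The formula for [H] is the case where [A] is the half-line up to [t],
    since a Lebesgue-Stieltjes integral against [F] is an expectation in [c]
    (lemma [integral_lebesgue_stieltjes]).

    If [c] has density [f], the two expectations are Lebesgue integrals of
    [x * f x] over the points of [0, 1] in [A], and of [(1 - x) * f x] over the
    points of [0, 1] whose mirror image [1 - x] is in [A]
    (lemma [integral_pdf], an instance of the chain rule
    [integral_density]).  Lebesgue measure is invariant under the reflection
    [x |-> 1 - x], which turns the second one into the integral of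
    [x * f (1 - x)] over the points of [0, 1] in [A]; adding up gives
    [x * (f x + f (1 - x))]. *)

(** * Independence and the uniform law *)

(** Two finite measures on a product that agree on rectangles are equal, and
    the value of the product measure on [E] is by definition the integral of
    the measures of the sections of [E]. *)
Lemma independent_joint_law (R : realType) (d : measure_display)
    (T : measurableType d) (P : probability T R) (X Y : {RV P >-> R}) :
  independent_RV X Y -> forall E : set (R * R), measurable E ->
  P [set w | E (X w, Y w)] =
  (\int[distribution P X]_x distribution P Y (xsection E x))%E.
Proof.
move=> XY E mE.
pose Z : T -> R * R := fun w => (X w, Y w).
have mZ : measurable_fun [set: T] Z.
  by apply/measurable_fun_pairP; split; exact: measurable_funP.
pose fZ := isMeasurableFun.Build _ _ _ _ Z mZ.
pose mfZ : {mfun T >-> (R * R)%type} := HB.pack Z fZ.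
have -> : P [set w | E (X w, Y w)] = distribution P mfZ E by [].
rewrite -(@product_measure_unique _ _ _ _ _ (distribution P X)
  (distribution P Y) (distribution P mfZ)).
- by [].
- exact: XY.
- by [].
Qed.

(** The event on [Y] may depend on the value of [X]: by independence one can
    freeze [X = x] and integrate the probability [g x] of the event [Y \in G x].
    The set [B] is there because [g] may be the right probability on [B] only:
    for [Y] uniform, [Y <= x] has probability [x] only if [x] is in [0, 1]. *)
Lemma independent_section_prob (R : realType) (d : measure_display)
    (T : measurableType d) (P : probability T R) (X Y : {RV P >-> R})
    (B : set R) (G : R -> set R) (g : R -> R) :
  independent_RV X Y -> measurable B ->
  measurable [set z : R * R | G z.1 z.2] -> measurable_fun B g ->
  (forall x, B x -> distribution P Y (G x) = (g x)%:E) ->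
  P [set w | B (X w) /\ G (X w) (Y w)] =
  (\int[P]_(w in X @^-1` B) (g (X w))%:E)%E.
Proof.
move=> XY mB mG mg PG.
have g0 x : B x -> 0 <= g x by move=> /PG gx; rewrite -lee_fin -gx.
transitivity (\int[distribution P X]_(x in B) (g x)%:E)%E; last first.
  rewrite ge0_integral_pushforward//; first exact/measurable_EFinP.
  by move=> x /set_mem/g0; rewrite lee_fin.
pose E := [set z : R * R | B z.1 /\ G z.1 z.2].
have mE : measurable E.
  have -> : E = (fst @^-1` B) `&` [set z : R * R | G z.1 z.2] by [].
  apply: measurableI => //.
  by rewrite -[X in measurable X]setTI; exact: measurable_fst.
rewrite [LHS](independent_joint_law XY mE) [RHS]integral_mkcond.
apply: eq_integral => x _; rewrite patchE; case: ifPn => [/set_mem|/negP] Bx.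
  rewrite -PG//; congr (distribution P Y _).
  by apply/seteqP; split => y; rewrite /xsection/= inE/= => // -[].
rewrite (_ : xsection E x = set0) ?measure0//.
by apply/seteqP; split => y //; rewrite /xsection/= inE/= => -[/mem_set].
Qed.

Lemma uniform_cdf (R : realType) (x : R) : 0 <= x <= 1 ->
  uniform_prob (@ltr01 R) `]-oo, x] = x%:E.
Proof.
move=> /andP[x0 x1].
rewrite /uniform_prob integral_uniform_pdf.
have -> : `]-oo, x]%classic `&` `[0, 1] = `[0, x]%classic.
  apply/seteqP; split => y /=; rewrite !in_itv/=.
    by move=> [-> /andP[-> _]].
  by move=> /andP[-> yx]; rewrite yx (le_trans yx).
rewrite (eq_integral (cst 1%E)); last first.
  move=> y; rewrite inE/= in_itv/= => /andP[y0 yx].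
  by rewrite /uniform_pdf y0 (le_trans yx)// subr0 invr1.
rewrite integral_cst//= lebesgue_measure_itv/= mul1e lte_fin.
by case: ltgtP x0 => // [_ _|<- _]; rewrite ?oppr0 ?adde0 // sube0.
Qed.

Lemma uniform_ccdf (R : realType) (x : R) : 0 <= x <= 1 ->
  uniform_prob (@ltr01 R) `]x, +oo[ = (1 - x)%:E.
Proof.
move=> x01.
rewrite -setCitvl probability_setC; last exact: measurable_itv.
by rewrite EFinB -(uniform_cdf x01).
Qed.

Lemma prob_uniform_le (R : realType) (d : measure_display)
    (T : measurableType d) (P : probability T R)
    (r c : {RV P >-> R}) (B : set R) :
  has_law r (uniform_prob (@ltr01 R)) -> independent_RV c r ->
  measurable B -> B `<=` `[0, 1] ->
  P [set w | B (c w) /\ r w <= c w] =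
  (\int[P]_(w in c @^-1` B) (c w)%:E)%E.
Proof.
move=> r_unif cr_indep mB B01.
apply: (independent_section_prob (G := fun x => `]-oo, x]%classic)
  (g := id)) => //.
  have -> : [set z : R * R | `]-oo, z.1]%classic z.2] =
            [set: R * R] `&` [set z | z.2 <= z.1].
    by rewrite setTI; apply/seteqP; split => z /=; rewrite in_itv.
  exact: measurable_fun_le.
move=> x /B01/=; rewrite in_itv/= => x01.
by rewrite r_unif// uniform_cdf.
Qed.

Lemma prob_uniform_gt (R : realType) (d : measure_display)
    (T : measurableType d) (P : probability T R)
    (r c : {RV P >-> R}) (B : set R) :
  has_law r (uniform_prob (@ltr01 R)) -> independent_RV c r ->
  measurable B -> B `<=` `[0, 1] ->
  P [set w | B (c w) /\ c w < r w] =
  (\int[P]_(w in c @^-1` B) (1 - c w)%R%:E)%E.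
Proof.
move=> r_unif cr_indep mB B01.
have -> : [set w | B (c w) /\ c w < r w] =
          [set w | B (c w) /\ `]c w, +oo[%classic (r w)].
  by apply/seteqP; split => w /=; rewrite in_itv/= andbT.
apply: (independent_section_prob (G := fun x => `]x, +oo[%classic)
  (g := fun x => 1 - x)) => //.
  have -> : [set z : R * R | `]z.1, +oo[%classic z.2] =
            ~` ([set: R * R] `&` [set z | z.2 <= z.1]).
    by rewrite setTI; apply/seteqP; split => z /=;
      rewrite in_itv/= andbT ltNge => /negP.
  by apply: measurableC; exact: measurable_fun_le.
  exact: measurable_funB.
move=> x /B01/=; rewrite in_itv/= => x01.
by rewrite r_unif// uniform_ccdf.
Qed.

(** * Densities and reflections *)

(** The chain rule for a measure with density [f].  By uniqueness of densities
    [f] is almost everywhere the Radon-Nikodym derivative of [nu], for which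
    the rule is known. *)
Lemma integral_density (d : measure_display) (T : measurableType d)
    (R : realType) (mu : {sigma_finite_measure set T -> \bar R})
    (nu : {finite_measure set T -> \bar R}) (f g : T -> R) (E : set T) :
  measurable_fun [set: T] f -> (forall x, 0 <= f x) ->
  (forall A, measurable A -> nu A = (\int[mu]_(x in A) (f x)%:E)%E) ->
  measurable E -> measurable_fun E g -> (forall x, E x -> 0 <= g x) ->
  (\int[nu]_(x in E) (g x)%:E = \int[mu]_(x in E) (g x * f x)%:E)%E.
Proof.
move=> mf f0 nuf mE mg g0.
have /measurable_EFinP mEf := mf.
have fi : mu.-integrable [set: T] (EFin \o f).
  apply/integrableP; split => //.
  under eq_integral do rewrite /= ger0_norm//.
  by rewrite -nuf// ltey_eq fin_num_measure.
have numu : nu `<< mu.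
  apply/null_content_dominatesP => A mA muA.
  rewrite nuf//; apply: null_set_integral => //.
  exact: measurable_funTS.
pose h := Radon_Nikodym_SigmaFinite.f nu mu.
have mh : measurable_fun [set: T] h.
  exact: measurable_int (Radon_Nikodym_SigmaFinite.f_integrable numu).
have fh : ae_eq mu [set: T] (EFin \o f) h.
  apply: integral_ae_eq => // A _ mA.
  by rewrite -nuf//; exact: Radon_Nikodym_SigmaFinite.f_integral.
(* Replacing [g] by its absolute value makes it nonnegative off [E] too. *)
pose g' := fun x => `|g x|.
have mg' : measurable_fun E (EFin \o g').
  by apply/measurable_EFinP; exact: measurableT_comp.
transitivity (\int[nu]_(x in E) (EFin \o g') x)%E.
  by apply: eq_integral => x /set_mem /g0 gx0; rewrite /= /g' ger0_norm.
rewrite -(Radon_Nikodym_SigmaFinite.change_of_variables numu)//; last first.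
  by move=> x; rewrite lee_fin /g' normr_ge0.
apply: ge0_ae_eq_integral => //.
- by apply: emeasurable_funM => //; exact: measurable_funTS.
- apply/measurable_EFinP; apply: measurable_funM => //.
  exact: measurable_funTS.
- move=> x _; rewrite mule_ge0 ?lee_fin ?/g'//.
  exact: Radon_Nikodym_SigmaFinite.f_ge0.
- by move=> x Ex; rewrite lee_fin mulr_ge0// g0.
apply: filterS fh => x /= /(_ I) fhx Ex.
by rewrite /g' ger0_norm ?g0// -/(h x) -fhx.
Qed.

Definition reflection (R : realType) (a : R) :
  measurableTypeR R -> measurableTypeR R := fun x => a - x.

Lemma measurable_reflection (R : realType) (a : R) :
  measurable_fun [set: measurableTypeR R] (reflection a).
Proof. exact: measurable_funB. Qed.

HB.instance Definition _ (R : realType) (a : R) :=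
  isMeasurableFun.Build _ _ _ _ (reflection a) (measurable_reflection a).

(** A measure on the line is determined by its values on the intervals
    [`]u, v]]; a reflection maps them to intervals closed on the other side, of
    the same length. *)
Lemma lebesgue_measure_reflection (R : realType) (a : R) (A : set R) :
  measurable A ->
  pushforward lebesgue_measure (reflection a) A = lebesgue_measure A.
Proof.
move=> mA; apply/esym/lebesgue_measure_unique => //= _ [[u v]] _ <-.
have preE : reflection a @^-1` `]u, v] = `[a - v, a - u[%classic.
  apply/seteqP; split => x /=; rewrite !in_itv/= /reflection;
    by move=> /andP[h1 h2]; apply/andP; split; lra.
rewrite /pushforward preE !lebesgue_measure_itv/= !lte_fin ltrD2l ltrN2.
by case: ifP => // _; rewrite -!EFinD; congr EFin; lra.
Qed.

Lemma integral_reflection (R : realType) (a : R) (A : set R) (f : R -> R) :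
  measurable A -> measurable_fun A f -> (forall x, A x -> 0 <= f x) ->
  (\int[lebesgue_measure]_(x in [set x | A (a - x)%R]) (f (a - x)%R)%:E =
   \int[lebesgue_measure]_(x in A) (f x)%:E)%E.
Proof.
move=> mA mf f0.
transitivity
    (\int[pushforward lebesgue_measure (reflection a)]_(x in A) (f x)%:E)%E.
  rewrite ge0_integral_pushforward//; first exact/measurable_EFinP.
  by move=> x /set_mem/f0; rewrite lee_fin.
by apply: eq_measure_integral => B mB _; exact: lebesgue_measure_reflection.
Qed.

(** * Integrals against the law of a real random variable *)

(** Lebesgue and Lebesgue-Stieltjes measures live on [measurableTypeR R], whose
    measurable sets are those of [R] but under another display; comparing them
    with the law of [c] requires to see [c] as valued in that type. *)
Definition borel_RV (R : realType) (d : measure_display)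
    (T : measurableType d) (P : probability T R) (c : {RV P >-> R}) :
    T -> measurableTypeR R := c.

Lemma measurable_borel_RV (R : realType) (d : measure_display)
    (T : measurableType d) (P : probability T R) (c : {RV P >-> R}) :
  measurable_fun [set: T] (borel_RV c).
Proof. by move=> _ Y mY; apply: (@measurable_funPT _ _ _ _ c). Qed.

HB.instance Definition _ (R : realType) (d : measure_display)
    (T : measurableType d) (P : probability T R) (c : {RV P >-> R}) :=
  isMeasurableFun.Build _ _ _ _ (borel_RV c) (measurable_borel_RV c).

Lemma integral_borel_law (R : realType) (d : measure_display)
    (T : measurableType d) (P : probability T R)
    (c : {RV P >-> R}) (B : set R) (g : R -> R) :
  measurable B -> measurable_fun B g -> (forall x, B x -> 0 <= g x) ->
  (\int[distribution P (borel_RV c)]_(x in B) (g x)%:E =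
   \int[P]_(w in c @^-1` B) (g (c w))%:E)%E.
Proof.
move=> mB mg g0.
rewrite ge0_integral_pushforward//; first exact/measurable_EFinP.
by move=> x /set_mem/g0; rewrite lee_fin.
Qed.

(** The Lebesgue-Stieltjes measure of the distribution function of [c] is the
    law of [c]; atoms are counted wherever they lie, so [B] can be a closed
    interval. *)
Lemma integral_lebesgue_stieltjes (R : realType) (d : measure_display)
    (T : measurableType d) (P : probability T R)
    (c : {RV P >-> R}) (F : cumulative R R) (B : set R) (g : R -> R) :
  (forall x, cdf c x = (F x)%:E) ->
  measurable B -> measurable_fun B g -> (forall x, B x -> 0 <= g x) ->
  (\int[lebesgue_stieltjes_measure F]_(x in B) (g x)%:E =
   \int[P]_(w in c @^-1` B) (g (c w))%:E)%E.
Proof.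
move=> hF mB mg g0; rewrite -integral_borel_law//.
by apply: eq_measure_integral => A mA _; exact: lebesgue_stieltjes_measure_law.
Qed.

Lemma integral_pdf (R : realType) (d : measure_display)
    (T : measurableType d) (P : probability T R)
    (c : {RV P >-> R}) (f g : R -> R) (B : set R) :
  has_pdf c f ->
  measurable B -> measurable_fun B g -> (forall x, B x -> 0 <= g x) ->
  (\int[P]_(w in c @^-1` B) (g (c w))%:E =
   \int[lebesgue_measure]_(x in B) (g x * f x)%:E)%E.
Proof.
move=> [mf f0 cf] mB mg g0; rewrite -integral_borel_law//.
exact: integral_density.
Qed.

(** * The law of the loss *)

(** The two terms are the cases [r <= c] and [c < r].  Both integrals are cut
    down to [c \in [0, 1]]: nothing is lost since [c] takes its values there,
    and it is only there that the uniform law has distribution function [x]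
    and that both integrands are nonnegative. *)
Lemma ell_law (R : realType) (d : measure_display)
    (T : measurableType d) (P : probability T R)
    (r c : {RV P >-> R}) (A : set R) :
  has_law r (uniform_prob (@ltr01 R)) -> (forall w, 0 <= c w <= 1) ->
  independent_RV c r ->
  measurable A ->
  distribution P (ell c r) A =
  (\int[P]_(w in c @^-1` (A `&` `[0%R, 1%R])) (c w)%:E +
   \int[P]_(w in c @^-1` ([set x | A (1 - x)%R] `&` `[0%R, 1%R]))
     (1 - c w)%R%:E)%E.
Proof.
move=> r_unif c01 cr_indep mA.
have m01 : measurable `[0 : R, 1] by exact: measurable_itv.
have mA' : measurable [set x | A (1 - x)].
  by rewrite -[X in measurable X]setTI; exact: measurable_funB.
rewrite -(prob_uniform_le r_unif cr_indep)//; last exact: measurableI.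
rewrite -(prob_uniform_gt r_unif cr_indep)//; last exact: measurableI.
have c_in w : c w \in `[0, 1] by rewrite in_itv/= c01.
have mle : measurable [set w | r w <= c w].
  by rewrite -[X in measurable X]setTI; exact: measurable_fun_le.
have mc B : measurable B -> measurable (c @^-1` B).
  by move=> mB; exact: measurable_funPTI.
rewrite -measureU//; first last.
- by apply/seteqP; split => w //= -[[_ rc] [_]]; rewrite ltNge rc.
- have -> : [set w | ([set x | A (1 - x)] `&` `[0, 1]) (c w) /\ c w < r w] =
      c @^-1` ([set x | A (1 - x)] `&` `[0, 1]) `\` [set w | r w <= c w].
    by apply/seteqP; split => w /= -[cw]; rewrite ltNge => /negP.
  by apply: measurableD => //; apply: mc; exact: measurableI.
- by apply: (@measurableI _ _ (c @^-1` (A `&` `[0, 1]))) => //;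
    apply: mc; exact: measurableI.
congr (P _); apply/seteqP; split => w /=; rewrite /ell.
  by case: leP => rc Aw; [left|right].
by case=> -[[Ac _] rc]; rewrite ?rc// leNgt rc.
Qed.

Theorem theorem5 (R : realType) (d : measure_display) (T : measurableType d)
    (P : probability T R) (r c : {RV P >-> R}) (F : cumulative R R)
    (hr : has_law r (uniform_prob (@ltr01 R)))
    (hc : forall w, 0 <= c w <= 1)
    (hind : independent_RV c r)
    (hF : forall x, cdf c x = (F x)%:E) :
  (forall t : R, 0 <= t <= 1 ->
     cdf (ell c r : {RV P >-> R}) t =
     (\int[lebesgue_stieltjes_measure F]_(x in `[0%R, t]) x%:E +
      \int[lebesgue_stieltjes_measure F]_(x in `[(1 - t)%R, 1%R])
        (1 - x)%R%:E)%E) /\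
  (forall f : R -> R, has_pdf c f ->
     has_pdf (ell c r : {RV P >-> R})
       (fun t => if 0 <= t <= 1 then t * (f t + f (1 - t)) else 0)).
Proof.
have m1B (B : set R) : measurable_fun B (fun x : R => 1 - x).
  exact: measurable_funB.
have ge0 (x : R) : `[0, 1]%classic x -> 0 <= x.
  by rewrite /= in_itv/= => /andP[].
have ge1B (x : R) : `[0, 1]%classic x -> 0 <= 1 - x.
  by rewrite /= in_itv/= subr_ge0 => /andP[].
split=> [t /andP[t0 t1]|f cf].
- rewrite /cdf (ell_law hr hc hind)//.
  have -> : `]-oo, t]%classic `&` `[0, 1] = `[0, t]%classic.
    apply/seteqP; split => x /=; rewrite !in_itv/=.
      by move=> [-> /andP[-> _]].
    by move=> /andP[-> xt]; rewrite xt (le_trans xt).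
  have -> : [set x | `]-oo, t]%classic (1 - x)] `&` `[0, 1] =
            `[1 - t, 1]%classic.
    apply/seteqP; split => x /=; rewrite !in_itv/=.
      by move=> [xt /andP[x0 x1]]; apply/andP; split; lra.
    by move=> /andP[tx x1]; split; [lra|apply/andP; split; lra].
  rewrite !(integral_lebesgue_stieltjes hF)//.
  + by move=> x /=; rewrite in_itv/= subr_ge0 => /andP[].
  + by move=> x /=; rewrite in_itv/= => /andP[].
- have [mf f0 _] := cf.
  have mfr : measurable_fun [set: R] (fun t => f (1 - t)).
    exact: measurableT_comp.
  split.
  + apply: measurable_fun_ifT => //.
      by apply: measurable_and => //; exact: measurable_fun_ler.
    by apply: measurable_funM => //; exact: measurable_funD.
  + move=> t; case: ifP => // /andP[t0 t1].
    by rewrite mulr_ge0// addr_ge0.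
  + move=> A mA.
    have m01 : measurable `[0 : R, 1] by exact: measurable_itv.
    have mA01 : measurable (A `&` `[0, 1]) by exact: measurableI.
    have mrA : measurable [set x | A (1 - x)].
      by rewrite -[X in measurable X]setTI; exact: measurable_funB.
    rewrite (ell_law hr hc hind)//.
    rewrite (integral_pdf (g := id) cf)//; last by move=> x [_ /ge0].
    rewrite (integral_pdf (g := fun x => 1 - x) cf)//; first last.
      * by move=> x [_ /ge1B].
      * exact: measurableI.
    have -> : [set x | A (1 - x)] `&` `[0, 1] =
              [set x | (A `&` `[0, 1]) (1 - x)].
      apply/seteqP; split => x /=; rewrite !in_itv/= => -[Ax /andP[x0 x1]];
        by split => //; apply/andP; split; lra.
    (* Write [x] as [1 - (1 - x)] so that the second integrand becomes the
       reflection of [x * f (1 - x)]. *)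
    have fE x : ((1 - x) * f x)%:E = ((1 - x) * f (1 - (1 - x)))%:E.
      by rewrite subKr.
    under [X in (_ + X)%E]eq_integral do rewrite fE.
    rewrite (integral_reflection 1 (f := fun x => x * f (1 - x)))//;
      last 2 first.
      * by apply: measurable_funTS; exact: measurable_funM.
      * by move=> x [_ /ge0 x0]; rewrite mulr_ge0.
    rewrite -ge0_integralD//; first last.
      * apply/measurable_EFinP; apply: measurable_funTS.
        exact: measurable_funM.
      * by move=> x [_ /ge0 x0]; rewrite lee_fin mulr_ge0.
      * apply/measurable_EFinP; apply: measurable_funTS.
        exact: measurable_funM.
      * by move=> x [_ /ge0 x0]; rewrite lee_fin mulr_ge0.
    rewrite integral_mkcondr; apply: eq_integral => x _.
    rewrite patchE mem_setE in_itv/=.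
    by case: ifP; rewrite // mulrDr EFinD.
Qed.
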